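(* Let $N$ be a normal subgroup of a finite group $G$. The equivalence classes in the equivalence relation with respect to $N$, defined on $\mathrm{Irr}(G)$, are detected in the character table of the group $G$. In particular, the size of $\mathrm{Irr}(G|\theta_i)$, for every $\theta_i\in\Omega$, is determined by the character table of $G$, as well as the rational numbers $\frac{e_\chi}{e_\phi}$ whenever $\chi,\phi\in\mathrm{Irr}(G|\theta_i)$, with $\chi_N=e_\chi\,\widehat{\theta_i}$ and $\phi_N=e_\phi\,\widehat{\theta_i}$.
   Context: Characters are over $\mathbb{C}$; $\mathrm{Irr}(X)$ is the set of irreducible characters of a group $X$, and $\chi_N$ is the restriction of $\chi$ to $N$. Two characters $\chi,\phi\in\mathrm{Irr}(G)$ are equivalent with respect to $N$ if $[\chi_N,\phi_N]\neq 0$, where $[\cdot,\cdot]$ is the usual inner product of characters of $N$; equivalently, if $\chi_N=c\,\phi_N$ for some rational number $c$. This is an equivalence relation on $\mathrm{Irr}(G)$. For $\theta\in\mathrm{Irr}(N)$, $\mathrm{Irr}(G|\theta)=\{\phi\in\mathrm{Irr}(G)\mid[\phi_N,\theta]\neq 0\}$; the equivalence class of $\chi$ is $\mathrm{Irr}(G|\theta)$ for any irreducible constituent $\theta$ of $\chi_N$. The group $G$ acts on $\mathrm{Irr}(N)$ by $\theta^g(x)=\theta(gxg^{-1})$ for $x\in N$, $g\in G$, and $\widehat{\theta}$ denotes the sum of the distinct $G$-conjugates of $\theta$. By Clifford's theorem, each $\chi\in\mathrm{Irr}(G|\theta)$ satisfies $\chi_N=e_\chi\widehat{\theta}$ for a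 positive integer $e_\chi$ (the ramification number). Let $k$ be the number of $G$-conjugacy classes contained in $N$, which equals the number of equivalence classes on $\mathrm{Irr}(G)$ with respect to $N$. Let $\Delta=\{\chi_1=1_G,\chi_2,\dots,\chi_k\}$ be a system of representatives of these equivalence classes, and let $\Omega=\{\theta_i\in\mathrm{Irr}(N)\mid 1\le i\le k\}$ be such that $\chi_i\in\mathrm{Irr}(G|\theta_i)$ for each $i$. The information is read off the submatrix of the character table of $G$ formed by the columns corresponding to the $G$-conjugacy classes contained in $N$, by looking at the rows of this submatrix that are proportional by rational numbers. *)

(* Defs.v *)
From HB Require Import structures.
From mathcomp Require Import all_boot all_order all_algebra all_fingroup.
From mathcomp Require Import all_solvable all_field all_character.
From mathcomp Require Import boolp.

Set Implicit Arguments.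
Unset Strict Implicit.
Unset Printing Implicit Defensive.

Import Order.TTheory GRing.Theory Num.Theory.

Local Open Scope ring_scope.

Section Defs.

Variables (gT : finGroupType) (G N : {group gT}).

Definition char_equiv (i j : Iirr G) : bool :=
  '['Res[N] 'chi_i, 'Res[N] 'chi_j] != 0.

Definition char_class (i : Iirr G) : {set Iirr G} := [set j | char_equiv i j].

(* Irr(G | theta) *)
Definition Irr_over (t : Iirr N) : {set Iirr G} :=
  [set i | '['Res[N] 'chi[G]_i, 'chi_t] != 0].

(* cfclass is a duplicate-free list, so this sums the distinct G-conjugates;
   (theta ^ g) x = theta (x ^ g^-1) = theta (g * x * g^-1). *)
Definition conj_sum (t : Iirr N) : 'CF(N) :=
  \sum_(xi <- ('chi_t ^: G)%CF) xi.

Definition ramified_by (i : Iirr G) (t : Iirr N) (e : nat) : Prop :=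
  'Res[N] 'chi_i = e%:R *: conj_sum t.

Definition classes_in : {set {set gT}} := [set C in classes G | C \subset N].

(* Delta = {'chi_(chi r)} and Omega = {'chi_(theta r)}; the index r = 0 carries
   the trivial character 'chi_0 = 1. *)
Definition rep_system (chi : 'I_#|classes_in| -> Iirr G)
    (theta : 'I_#|classes_in| -> Iirr N) : Prop :=
  [/\ forall r : 'I_#|classes_in|, r = 0%N :> nat -> chi r = 0,
      forall i, exists! r, char_equiv (chi r) i
    & forall r, chi r \in Irr_over (theta r)].

Definition columns_in : {set Iirr G} := [set j : Iirr G | irr_class j \subset N].

Definition table_on : 'M[algC]_(Nirr G, #|columns_in|) :=
  colsub (fun j : 'I_#|columns_in| => enum_val j) (character_table G).

End Defs.

Definition rows_rat_prop m n (A : 'M[algC]_(m, n)) (i j : 'I_m) : Prop :=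
  exists c : rat, row i A = ratr c *: row j A.

(* The character tables of G and G' agree up to a relabelling s of the rows and
   t of the columns, and t matches the classes inside N with those inside N'. *)
Definition same_table (gT gT' : finGroupType) (G N : {group gT})
    (G' N' : {group gT'}) (s t : Iirr G -> Iirr G') : Prop :=
  [/\ bijective s, bijective t,
      forall i j, character_table G i j = character_table G' (s i) (t j)
    & forall j, (j \in columns_in G N) = (t j \in columns_in G' N')].

(* Main.v *)
(** By Clifford's theorem ['Res[N] 'chi_i] is a natural multiple of the sum of a
    [G]-orbit on [Irr N], and sums of distinct orbits are orthogonal; hence
    restrictions to [N] are non-orthogonal exactly when they are rationally
    proportional.  As [N] is a union of [G]-classes, this proportionality is that
    of the rows of the subtable on the classes inside [N], the rational factor
    being the quotient of the ramification numbers. *)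

Require Import Defs.
From HB Require Import structures.
From mathcomp Require Import all_boot all_order all_algebra all_fingroup.
From mathcomp Require Import all_solvable all_field all_character.
From mathcomp Require Import boolp.

Set Implicit Arguments.
Unset Strict Implicit.
Unset Printing Implicit Defensive.

Import Order.TTheory GRing.Theory Num.Theory.

Local Open Scope ring_scope.

Section RestrictionClasses.

Variables (gT : finGroupType) (G N : {group gT}).
Hypothesis nNG : (N <| G)%g.

(** By Clifford both restrictions are multiples of the same orbit sum; the factors are the
    multiplicities of ['chi_t], natural numbers, and [c] is their quotient. *)
Lemma Irr_over_rat_prop (t : Iirr N) (i j : Iirr G) :
    i \in Irr_over G t -> j \in Irr_over G t ->
  exists c : rat, 'Res[N] 'chi_i = ratr c *: 'Res[N] 'chi_j.
Proof.
have nat_dot k : '['Res[N, G] 'chi_k, 'chi_t] \in Num.nat.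
  by rewrite Cnat_cfdot_char ?cfRes_char ?irr_char.
rewrite !inE => ti tj.
have Ri := Clifford_Res_sum_cfclass nNG ti.
have Rj := Clifford_Res_sum_cfclass nNG tj.
rewrite {}Ri {}Rj; move: ti tj.
have /natrP[a ->] := nat_dot i; have /natrP[b ->] := nat_dot j => _ b0.
exists (a%:R / b%:R); rewrite scalerA fmorph_div /= !ratr_nat.
by rewrite divfK.
Qed.

Lemma char_equivP (i j : Iirr G) :
  char_equiv N i j <-> exists c : rat, 'Res[N] 'chi_i = ratr c *: 'Res[N] 'chi_j.
Proof.
split=> [eij | [c Dij]]; last first.
  rewrite /char_equiv Dij cfdotZl mulf_neq0 ?cfnorm_eq0 ?Res_irr_neq0 //.
  (* If [c] were zero, the restriction of ['chi_i] would vanish. *)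
  by apply: contra_eq_neq Dij => ->; rewrite scale0r Res_irr_neq0.
(* Non-orthogonal restrictions share an irreducible constituent [u], since the inner product expands
   over [Irr N]. *)
have /existsP[u /andP[ui uj]] :
    [exists u : Iirr N, (i \in Irr_over G u) && (j \in Irr_over G u)].
  apply: contraR eij => /existsPn no_u.
  rewrite cfdot_sum_irr big1 // => u _; move: (no_u u).
  by rewrite !inE negb_and !negbK => /orP[]/eqP->; rewrite ?conjC0 ?mul0r ?mulr0.
exact: Irr_over_rat_prop ui uj.
Qed.

(** This trades a character of [N], invisible in the table of [G], for a member of the class. *)
Lemma Irr_over_char_class (t : Iirr N) (i : Iirr G) :
  i \in Irr_over G t -> Irr_over G t = char_class N i.
Proof.
move=> ti; apply/setP=> j; rewrite [RHS]inE.
apply/idP/idP=> [tj | /char_equivP[c Dij]].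
  by apply/char_equivP; apply: Irr_over_rat_prop ti tj.
by move: ti; rewrite !inE Dij cfdotZl mulf_eq0 => /norP[].
Qed.

(** Normality makes [N] a union of [G]-classes, so the values of a restriction to [N] are exactly
    the table entries in the columns inside [N]. *)
Lemma char_table_rat_propP (i j : Iirr G) (c : rat) :
  'Res[N] 'chi_i = ratr c *: 'Res[N] 'chi_j <->
    {in columns_in G N, forall k,
      character_table G i k = ratr c * character_table G j k}.
Proof.
have [sNG nGN] := andP nNG.
split=> [Dij k | Dij].
  rewrite inE => /subsetP sCN; rewrite !mxE.
  have Nk : repr (irr_class k) \in N.
    apply: sCN; have /imsetP[x _ ->] := irr_classP k.
    exact: mem_repr (class_refl G x).
  by move/cfunP: Dij => /(_ (repr (irr_class k))); rewrite cfunE !cfResE.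
apply/cfun_inP=> x Nx; have Gx := subsetP sNG x Nx.
have := Dij (class_Iirr G (x ^: G)%g); rewrite inE class_IirrK ?mem_classes //.
rewrite class_sub_norm // !mxE class_IirrK ?mem_classes // !cfun_repr.
by rewrite cfunE !cfResE // => ->.
Qed.

Lemma row_table_on_propP (i j : Iirr G) (c : rat) :
  row i (table_on G N) = ratr c *: row j (table_on G N) <->
    'Res[N] 'chi_i = ratr c *: 'Res[N] 'chi_j.
Proof.
rewrite char_table_rat_propP; split=> [/rowP Dij k Nk | Dij].
  by have := Dij (enum_rank_in Nk k); rewrite !mxE enum_rankK_in.
by apply/rowP=> k; have := Dij _ (enum_valP k); rewrite !mxE.
Qed.

Lemma char_class_rows (i : Iirr G) :
  char_class N i = [set j | `[< rows_rat_prop (table_on G N) i j >]].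
Proof.
apply/setP=> j; rewrite !inE; apply/idP/asboolP=> [/char_equivP[c] | [c]].
  by exists c; apply/row_table_on_propP.
by move/row_table_on_propP=> Dij; apply/char_equivP; exists c.
Qed.

Lemma row_ratio_ramified (t : Iirr N) (i j : Iirr G) (ei ej : nat) (c : rat) :
    ramified_by i t ei -> ramified_by j t ej ->
  row i (table_on G N) = ratr c *: row j (table_on G N) <-> c = ei%:R / ej%:R.
Proof.
(* The restriction of ['chi_j] is nonzero, so [ej] and the orbit sum are too: the quotient is a
   genuine one and the factor is unique. *)
move=> Di Dj; have := Res_irr_neq0 N j.
rewrite row_table_on_propP Di Dj scaler_eq0 pnatr_eq0 => /norP[ej0 S0].
rewrite scalerA -(ratr_nat algC ej) -(ratr_nat algC ei) -rmorphM /=.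
split=> [/eqP|->]; last by rewrite divfK ?pnatr_eq0.
rewrite -subr_eq0 -scalerBl scaler_eq0 (negPf S0) orbF subr_eq0 => /eqP/fmorph_inj->.
by rewrite mulfK ?pnatr_eq0.
Qed.

End RestrictionClasses.

Section SameTable.

Variables (gT gT' : finGroupType) (G N : {group gT}) (G' N' : {group gT'}).
Hypotheses (nNG : (N <| G)%g) (nNG' : (N' <| G')%g).
Variables s t : Iirr G -> Iirr G'.
Hypothesis st : same_table N N' s t.

Lemma same_table_row_prop (i j : Iirr G) (c : rat) :
  row i (table_on G N) = ratr c *: row j (table_on G N) <->
    row (s i) (table_on G' N') = ratr c *: row (s j) (table_on G' N').
Proof.
have [_ [t' tK t'K] Dst Nt] := st.
rewrite !row_table_on_propP // !char_table_rat_propP //; split=> Dij k.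
  (* Every column [k] of the second table is [t (t' k)]. *)
  by rewrite -[k]t'K -Nt -!Dst; apply: Dij.
by rewrite Nt !Dst; apply: Dij.
Qed.

Lemma same_table_char_class (i : Iirr G) :
  s @: char_class N i = char_class N' (s i).
Proof.
have [[s' sK s'K] _ _ _] := st.
rewrite !char_class_rows //; apply/setP=> j.
rewrite -[j]s'K mem_imset ?inE; last exact: can_inj sK.
apply/asboolP/asboolP=> -[c]; first by move/same_table_row_prop; exists c.
by move/(same_table_row_prop _ _ _).2; exists c.
Qed.

End SameTable.

Theorem corollary4p6 (gT : finGroupType) (G N : {group gT}) (nNG : (N <| G)%g) :
  [/\ (* how the information is read off the table of G *)
      forall i : Iirr G,
        char_class N i = [set j | `[< rows_rat_prop (table_on G N) i j >]],
      forall (chi : 'I_#|classes_in G N| -> Iirr G)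
             (theta : 'I_#|classes_in G N| -> Iirr N),
        rep_system chi theta ->
        forall r,
          #|Irr_over G (theta r)|
            = #|[set j | `[< rows_rat_prop (table_on G N) (chi r) j >]]| /\
          (forall (i j : Iirr G) (ei ej : nat),
             i \in Irr_over G (theta r) -> j \in Irr_over G (theta r) ->
             ramified_by i (theta r) ei -> ramified_by j (theta r) ej ->
             forall c : rat,
               row i (table_on G N) = ratr c *: row j (table_on G N)
                 <-> c = ei%:R / ej%:R)
    & (* groups with the same table share this information *)
      forall (gT' : finGroupType) (G' N' : {group gT'}) (s t : Iirr G -> Iirr G'),
        (N' <| G')%g -> same_table N N' s t ->
        (forall i, s @: char_class N i = char_class N' (s i)) /\
        (forall (chi : 'I_#|classes_in G N| -> Iirr G)
                (theta : 'I_#|classes_in G N| -> Iirr N)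
                (chi' : 'I_#|classes_in G' N'| -> Iirr G')
                (theta' : 'I_#|classes_in G' N'| -> Iirr N'),
           rep_system chi theta -> rep_system chi' theta' ->
           forall r r', s (chi r) \in Irr_over G' (theta' r') ->
             #|Irr_over G (theta r)| = #|Irr_over G' (theta' r')| /\
             (forall (i j : Iirr G) (ei ej ei' ej' : nat),
                i \in Irr_over G (theta r) -> j \in Irr_over G (theta r) ->
                ramified_by i (theta r) ei -> ramified_by j (theta r) ej ->
                ramified_by (s i) (theta' r') ei' ->
                ramified_by (s j) (theta' r') ej' ->
                ei%:R / ej%:R = ei'%:R / ej'%:R :> rat))].
Proof.
split=> [i | chi theta [_ _ chi_theta] r | gT' G' N' s t nNG' st].
- exact: char_class_rows.
- split=> [|i j ei ej _ _ Di Dj c]; last exact: row_ratio_ramified Di Dj.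
  by rewrite (Irr_over_char_class nNG (chi_theta r)) char_class_rows.
split=> [i | chi theta chi' theta' [_ _ chi_theta] _ r r' over_r'].
  exact: (same_table_char_class nNG nNG' st).
split=> [|i j ei ej ei' ej' _ _ Di Dj Di' Dj'].
  rewrite (Irr_over_char_class nNG (chi_theta r)) (Irr_over_char_class nNG' over_r').
  rewrite -(same_table_char_class nNG nNG' st) card_imset //.
  by have [/bij_inj] := st.
(* The relabelling keeps the factor [ei / ej] between rows [i] and [j]; by uniqueness it is the
   quotient attached to [s i] and [s j]. *)
apply/(row_ratio_ramified nNG' _ Di' Dj')/(same_table_row_prop nNG nNG' st).
exact/(row_ratio_ramified nNG _ Di Dj).
Qed.
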